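(* For each $i\in\{1,2\}$, let $D_i$ be a set with $|D_i|\ge3$, let $a_i,b_i,0_{\dashv,i}\in D_i$ be pairwise distinct, let $c_i,0_{\vdash,i}\in D_i$ be such that $a_i,c_i,0_{\vdash,i}$ are pairwise distinct, and let $(D_i,\dashv_i,\vdash_i)$ be the $g$-dimonoid defined by $$ x\dashv_i y= \begin{cases} b_i,&\text{if }x=y=a_i\\ 0_{\dashv,i},&\text{otherwise} \end{cases} \quad\text{and}\quad x\vdash_i y= \begin{cases} c_i,&\text{if }x=y=a_i\\ 0_{\vdash,i},&\text{otherwise}. \end{cases} $$ Then $(D_1,\dashv_1,\vdash_1)\cong(D_2,\dashv_2,\vdash_2)$ if and only if there exists a bijection $\psi:D_1\to D_2$ such that $$ \psi(a_1)=a_2,\quad \psi(b_1)=b_2,\quad \psi(c_1)=c_2,\quad \psi(0_{\dashv,1})=0_{\dashv,2},\quad \psi(0_{\vdash,1})=0_{\vdash,2}. $$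
   Context: A $g$-dimonoid is a set $D$ with two associative binary operations $\dashv,\vdash$ satisfying, for all $x,y,z\in D$, $(x\dashv y)\dashv z=x\dashv(y\vdash z)$ and $(x\dashv y)\vdash z=x\vdash(y\vdash z)$. An isomorphism of $g$-dimonoids is a bijection preserving both operations; $\cong$ means that an isomorphism exists. *)

(* Defs.v *)
From mathcomp Require Import all_boot.
From mathcomp Require Import boolp classical_sets functions cardinality.

Set Implicit Arguments.
Unset Strict Implicit.
Unset Printing Implicit Defensive.

(* ldash is the operation written \dashv, rdash the one written \vdash. *)
Record gDimonoid := GDimonoid {
  carrier :> Type;
  ldash : carrier -> carrier -> carrier;
  rdash : carrier -> carrier -> carrier;
  ldashA : associative ldash;
  rdashA : associative rdash;
  ldash_ldash : forall x y z, ldash (ldash x y) z = ldash x (rdash y z);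
  rdash_ldash : forall x y z, rdash (ldash x y) z = rdash x (rdash y z)
}.

Definition isomorphic (D E : gDimonoid) : Prop :=
  exists f : D -> E,
    [/\ bijective f,
        {morph f : x y / ldash x y >-> ldash x y}
      & {morph f : x y / rdash x y >-> rdash x y}].

Definition distinct3 (T : Type) (x y z : T) : Prop :=
  [/\ x <> y, x <> z & y <> z].

(* Excluded middle gives the case distinction on x = y = a, so that no
   decidable equality is required of T. *)
Definition point_mul (T : Type) (a b o : T) (x y : T) : T :=
  if `[< x = a /\ y = a >] then b else o.

Section PointGDimonoid.
Variables (T : Type) (a b ol c or : T).
Hypotheses (dl : distinct3 a b ol) (dr : distinct3 a c or).

Lemma point_mul_neq (b' o' x y : T) :
  a <> b' -> a <> o' -> point_mul a b' o' x y <> a.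
Proof. by rewrite /point_mul; case: ifP => _ nab nao /esym. Qed.

Lemma point_mul_l (b' o' x y : T) : x <> a -> point_mul a b' o' x y = o'.
Proof. by rewrite /point_mul => nxa; case: asboolP => // -[]. Qed.

Lemma point_mul_r (b' o' x y : T) : y <> a -> point_mul a b' o' x y = o'.
Proof. by rewrite /point_mul => nya; case: asboolP => // -[]. Qed.

Let l_neq x y : point_mul a b ol x y <> a.
Proof. by case: dl => ? ? _; exact: point_mul_neq. Qed.

Let r_neq x y : point_mul a c or x y <> a.
Proof. by case: dr => ? ? _; exact: point_mul_neq. Qed.

Fact point_ldashA : associative (point_mul a b ol).
Proof. by move=> x y z; rewrite point_mul_r // point_mul_l. Qed.

Fact point_rdashA : associative (point_mul a c or).
Proof. by move=> x y z; rewrite point_mul_r // point_mul_l. Qed.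

Fact point_ldash_ldash x y z :
  point_mul a b ol (point_mul a b ol x y) z =
  point_mul a b ol x (point_mul a c or y z).
Proof. by rewrite point_mul_l // point_mul_r. Qed.

Fact point_rdash_ldash x y z :
  point_mul a c or (point_mul a b ol x y) z =
  point_mul a c or x (point_mul a c or y z).
Proof. by rewrite point_mul_l // point_mul_r. Qed.

Definition point_gDimonoid : gDimonoid :=
  GDimonoid point_ldashA point_rdashA point_ldash_ldash point_rdash_ldash.

End PointGDimonoid.

(* Main.v *)
Require Import Defs.
From mathcomp Require Import all_boot.
From mathcomp Require Import boolp classical_sets functions cardinality.

Local Open Scope classical_set_scope.
Local Open Scope card_scope.

(** The two operations can be treated separately, since each has the same shape
[point_mul a b o]: a single product, [a * a], takes the value [b] and all
others take the value [o].  When [a], [b], [o] are distinct, the operation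
determines the triple [(a, b, o)]: [a] is the only element [x] for which the
products [x * y] depend on [y], [b] is its square, and [o] is the value of every
other product.  Hence an injection is a
morphism exactly when it sends triple to triple ([point_mul_morphP]), and an
isomorphism of the g-dimonoids is a bijection doing so for both triples. *)

Lemma point_mul_id (T : Type) (a b o : T) : point_mul a b o a a = b.
Proof. by rewrite /point_mul; case: asboolP => // -[]. Qed.

(** If [f a] were not [a'], all products with [f a] on the left would be [o'];
then [b = a * a] and [o = a * b] would have the same image.  Once [f a = a'],
the images of [b = a * a] and [o = a * b] can be read off, the second because
[f b] differs from [f a] by injectivity.  Conversely, injectivity makes
[x = y = a] equivalent to [f x = f y = a'], so a map of the triples commutes
with the case distinction. *)
Lemma point_mul_morphP (T T' : Type) (a b o : T) (a' b' o' : T') (f : T -> T') :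
  injective f -> a <> b -> b <> o ->
  {morph f : x y / point_mul a b o x y >-> point_mul a' b' o' x y} <->
  [/\ f a = a', f b = b' & f o = o'].
Proof.
move=> finj nab nbo; split=> [fM | [fa fb fo] x y].
  have fbE : f b = point_mul a' b' o' (f a) (f a) by rewrite -fM point_mul_id.
  have foE : f o = point_mul a' b' o' (f a) (f b).
    by rewrite -fM point_mul_r // => /esym.
  have fa : f a = a'.
    apply: contrapT => nfa; apply/nbo/finj.
    by rewrite fbE foE !point_mul_l.
  split=> //; first by rewrite fbE fa point_mul_id.
  by rewrite foE point_mul_r // -fa => /finj /esym.
have [[-> ->]|nxy] := pselect (x = a /\ y = a).
  by rewrite fa !point_mul_id.
rewrite /point_mul asboolF // asboolF // -fa.
by case=> /finj xa /finj ya; apply: nxy.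
Qed.

Theorem proposition3p2
  (D1 : Type) (a1 b1 ol1 c1 or1 : D1)
  (D2 : Type) (a2 b2 ol2 c2 or2 : D2)
  (card1 : [set: 'I_3] #<= [set: D1])
  (card2 : [set: 'I_3] #<= [set: D2])
  (dl1 : distinct3 a1 b1 ol1) (dr1 : distinct3 a1 c1 or1)
  (dl2 : distinct3 a2 b2 ol2) (dr2 : distinct3 a2 c2 or2) :
  isomorphic (point_gDimonoid dl1 dr1) (point_gDimonoid dl2 dr2) <->
  exists psi : D1 -> D2,
    bijective psi /\
    [/\ psi a1 = a2, psi b1 = b2, psi c1 = c2,
        psi ol1 = ol2 & psi or1 = or2].
Proof.
have [nab _ nbo] := dl1; have [nac _ nco] := dr1.
split=> [[f [fbij fl fr]] | [f [fbij [fa fb fc fol for_]]]]; exists f.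
  have finj := bij_inj fbij.
  have [fa fb fol] := (point_mul_morphP _ _ _ _ _ _ _ _ _ finj nab nbo).1 fl.
  by have [_ fc for_] := (point_mul_morphP _ _ _ _ _ _ _ _ _ finj nac nco).1 fr.
by split=> //=; apply/point_mul_morphP => //; exact: bij_inj.
Qed.
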